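(* Let $\mathcal{DM}on$ be the category of Dijkstra monads and let $\mathcal{M}on\mathcal{R}el$ be the category of monadic relations (no orders involved). For a monadic relation $\mathcal R : M \leftrightarrow W$ set $(\mathfrak{pre}\,\mathcal R)\,A\,w = (m : M A) \times (m\,\mathcal R_A\,w)$. This is a Dijkstra monad over $W$, with return and bind given by those of $M$, and $\mathfrak{pre}$ extends to a functor $\mathcal{M}on\mathcal{R}el \to \mathcal{DM}on$, sending $(\Theta^M,\Theta^W)$ to $(\Theta^W,\Theta^{\mathcal D})$ with $\Theta^{\mathcal D}_{A,w}$ the restriction of $\Theta^M_A$. For a Dijkstra monad $\mathcal D$ over $W$ set $\int\mathcal D\,A = (w : W A)\times \mathcal D\,A\,w$. This is a monad, with return and bind given componentwise by those of $W$ and $\mathcal D$; the first projection $\pi_1 : \int\mathcal D \to W$ is a monad morphism; and sending $\mathcal D$ to the graph of $\pi_1$ extends to a functor $\int : \mathcal{DM}on \to \mathcal{M}on\mathcal{R}el$, sending $(\Theta^W,\Theta^{\mathcal D})$ to $(\Theta^M,\Theta^W)$ with $\Theta^M_A(w,m) = (\Theta^W(w), \Theta^{\mathcal D}_{A,w}(m))$. Then: (1) $\int$ is left adjoint to $\mathfrak{pre}$, i.e. there is a natural bijection $\mathcal{M}on\mathcal{R}el(\int\mathcal D, \mathcal R) \cong \mathcal{DM}on(\mathcal D, \mathfrak{pre}\,\mathcal R)$. (2) The unit $\mathcal D \to \mathfrak{pre}(\int\mathcal D)$ is an isomorphism for every Dijkstra monad $\mathcal D$. (3) The counit $\int(\mathfrak{pre}\,\mathcal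 R) \to \mathcal R$ is an isomorphism if and only if $\mathcal R$ is functional, i.e. is the graph of a monad morphism $M \to W$. (4) Consequently the adjunction restricts to an equivalence of categories between $\mathcal{DM}on$ and the full subcategory of $\mathcal{M}on\mathcal{R}el$ on the (graphs of) monad morphisms.
   Context: The setting is an extensional dependent type theory with dependent products, strong sums, identity types, a type $\mathbb P$ of proof-irrelevant propositions, and quotients. A monad $M$ is a type constructor with $\mathrm{ret}^M : A \to M A$ and $\mathrm{bind}^M : M A \to (A \to M B) \to M B$ satisfying the usual monad laws. A monad morphism is a family of maps $M A \to W A$ preserving ret and bind. A Dijkstra monad over a monad $W$ consists of a type $\mathcal D\,A\,w$ for each type $A$ and $w : W A$, together with $\mathrm{ret}^{\mathcal D} : (x:A) \to \mathcal D\,A\,(\mathrm{ret}^W x)$ and $\mathrm{bind}^{\mathcal D} : \mathcal D\,A\,w_1 \to ((x:A)\to \mathcal D\,B\,(w_2\,x)) \to \mathcal D\,B\,(\mathrm{bind}^W w_1\,w_2)$, such that $\mathrm{bind}^{\mathcal D}\,m\,\mathrm{ret}^{\mathcal D} = m$, $\mathrm{bind}^{\mathcal D}(\mathrm{ret}^{\mathcal D}x) f = f\,x$ and $\mathrm{bind}^{\mathcal D}(\mathrm{bind}^{\mathcal D} m f) g = \mathrm{bind}^{\mathcal D} m (\lambda x.\,\mathrm{bind}^{\mathcal D}(f x) g)$. These equations are well typed thanks to the monad laws of $W$. A morphism of Dijkstra monads from $\mathcal D_1$ (over $W_1$) to $\mathcal D_2$ (over $W_2$) is a pair $(\Theta^W,\Theta^{\mathcal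 D})$ of a monad morphism $\Theta^W : W_1\to W_2$ and a family of maps $\Theta^{\mathcal D}_{A,w} : \mathcal D_1\,A\,w \to \mathcal D_2\,A\,(\Theta^W w)$ such that $\Theta^{\mathcal D}(\mathrm{ret}^{\mathcal D_1}x) = \mathrm{ret}^{\mathcal D_2}x$ and $\Theta^{\mathcal D}(\mathrm{bind}^{\mathcal D_1} m f) = \mathrm{bind}^{\mathcal D_2}(\Theta^{\mathcal D}m)(\Theta^{\mathcal D}\circ f)$. These form the category $\mathcal{DM}on$, whose objects are pairs $(W,\mathcal D)$. A monadic relation $\mathcal R : M\leftrightarrow W$ between monads $M, W$ is a family of relations $\mathcal R_A : M A\times W A\to\mathbb P$ such that $(\mathrm{ret}^M v)\,\mathcal R_A\,(\mathrm{ret}^W v)$ for all $v:A$, and such that whenever $m_1\,\mathcal R_A\,w_1$ and $(m_2\,x)\,\mathcal R_B\,(w_2\,x)$ for all $x:A$, then $(\mathrm{bind}^M m_1 m_2)\,\mathcal R_B\,(\mathrm{bind}^W w_1 w_2)$. The category $\mathcal{M}on\mathcal{R}el$ has as objects triples $(M,W,\mathcal R)$ with $\mathcal R : M\leftrightarrow W$ a monadic relation. A morphism from $\mathcal R^1 : M_1\leftrightarrow W_1$ to $\mathcal R^2 : M_2\leftrightarrow W_2$ is a pair of monad morphisms $\Theta^M : M_1\to M_2$, $\Theta^W : W_1\to W_2$ such that $m\,\mathcal R^1_A\,w$ implies $\Theta^M(m)\,\mathcal R^2_A\,\Theta^W(w)$. The graph of a monad morphism is a monadic relation. *)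

(* Defs.v *)
(* Plain Rocq with the standard library.  The ambient extensional type theory
   is rendered by Leibniz equality together with functional extensionality and
   proof irrelevance; the type of propositions is [Prop]. *)
From Stdlib Require Import FunctionalExtensionality ProofIrrelevance.
Import EqNotations.

Set Implicit Arguments.
Unset Strict Implicit.
Unset Printing Implicit Defensive.

(** * Categories *)

Record Category := {
  Ob :> Type;
  Hom : Ob -> Ob -> Type;
  idm : forall X, Hom X X;
  comp : forall {X Y Z}, Hom Y Z -> Hom X Y -> Hom X Z;
  comp_idl : forall X Y (f : Hom X Y), comp (idm Y) f = f;
  comp_idr : forall X Y (f : Hom X Y), comp f (idm X) = f;
  comp_assoc : forall X Y Z T (h : Hom Z T) (g : Hom Y Z) (f : Hom X Y),
    comp (comp h g) f = comp h (comp g f)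
}.
Arguments Hom {c} _ _.
Arguments idm {c} X.
Arguments comp {c X Y Z} _ _.

Definition is_iso (C : Category) (X Y : C) (f : Hom X Y) : Prop :=
  exists g : Hom Y X, comp g f = idm X /\ comp f g = idm Y.

Record is_functor (C D : Category) (ob : C -> D)
    (hom : forall X Y : C, Hom X Y -> Hom (ob X) (ob Y)) : Prop := {
  functor_id : forall X : C, hom X X (idm X) = idm (ob X);
  functor_comp : forall (X Y Z : C) (g : Hom Y Z) (f : Hom X Y),
    hom X Z (comp g f) = comp (hom Y Z g) (hom X Y f)
}.

Record Functor (C D : Category) := {
  fob :> C -> D;
  fmap : forall X Y : C, Hom X Y -> Hom (fob X) (fob Y);
  functor_laws : is_functor fmap
}.
Arguments fmap {C D} F {X Y} _ : rename.

(** [L] is left adjoint to [R]: a bijection on hom-sets, natural in both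
    variables. *)
Record Adjunction (C D : Category) (L : Functor C D) (R : Functor D C) := {
  adj_to : forall (X : C) (Y : D), Hom (L X) Y -> Hom X (R Y);
  adj_from : forall (X : C) (Y : D), Hom X (R Y) -> Hom (L X) Y;
  adj_toK : forall X Y (f : Hom (L X) Y), adj_from (adj_to f) = f;
  adj_fromK : forall X Y (g : Hom X (R Y)), adj_to (adj_from g) = g;
  adj_natural : forall (X X' : C) (Y Y' : D)
      (h : Hom X' X) (k : Hom Y Y') (f : Hom (L X) Y),
    adj_to (comp k (comp f (fmap L h))) = comp (fmap R k) (comp (adj_to f) h)
}.

Definition unit (C D : Category) (L : Functor C D) (R : Functor D C)
    (adj : Adjunction L R) (X : C) : Hom X (R (L X)) :=
  adj_to adj (idm (L X)).

Definition counit (C D : Category) (L : Functor C D) (R : Functor D C)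
    (adj : Adjunction L R) (Y : D) : Hom (L (R Y)) Y :=
  adj_from adj (idm (R Y)).

(** Equivalence of categories with given underlying functors: natural
    isomorphisms from the identity to [G F] and from [F G] to the identity. *)
Record Equivalence (C D : Category) (F : Functor C D) (G : Functor D C) := {
  eqv_eta : forall X : C, Hom X (G (F X));
  eqv_eps : forall Y : D, Hom (F (G Y)) Y;
  eqv_eta_natural : forall (X X' : C) (h : Hom X X'),
    comp (eqv_eta X') h = comp (fmap G (fmap F h)) (eqv_eta X);
  eqv_eps_natural : forall (Y Y' : D) (k : Hom Y Y'),
    comp (eqv_eps Y') (fmap F (fmap G k)) = comp k (eqv_eps Y);
  eqv_eta_iso : forall X, is_iso (eqv_eta X);
  eqv_eps_iso : forall Y, is_iso (eqv_eps Y)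
}.

Definition FullSub (C : Category) (P : C -> Prop) : Category := {|
  Ob := {X : C | P X};
  Hom := fun X Y => @Hom C (proj1_sig X) (proj1_sig Y);
  idm := fun X => @idm C (proj1_sig X);
  comp := fun X Y Z g f => @comp C _ _ _ g f;
  comp_idl := fun X Y f => comp_idl f;
  comp_idr := fun X Y f => comp_idr f;
  comp_assoc := fun X Y Z T h g f => comp_assoc h g f
|}.

Definition corestrict (C D : Category) (P : D -> Prop) (F : Functor C D)
    (HF : forall X, P (F X)) : Functor C (FullSub P).
Proof.
  refine (@Build_Functor C (FullSub P)
    (fun X => exist P (F X) (HF X)) (fun X Y f => fmap F f) _).
  split; intros;
    [apply (functor_id (functor_laws F)) | apply (functor_comp (functor_laws F))].
Defined.

Definition restrict (C D : Category) (P : C -> Prop) (F : Functor C D) :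
  Functor (FullSub P) D.
Proof.
  refine (@Build_Functor (FullSub P) D
    (fun X => F (proj1_sig X)) (fun X Y f => @fmap C D F _ _ f) _).
  split; intros;
    [apply (functor_id (functor_laws F)) | apply (functor_comp (functor_laws F))].
Defined.

(** * Monads *)

Record MonadData := {
  carrier :> Type -> Type;
  ret : forall A, A -> carrier A;
  bind : forall A B, carrier A -> (A -> carrier B) -> carrier B
}.
Arguments ret M {A} _ : rename.
Arguments bind M {A B} _ _ : rename.

Record is_monad (M : MonadData) : Prop := {
  bind_ret_r : forall A (m : M A), bind M m (ret M) = m;
  bind_ret_l : forall A B (x : A) (f : A -> M B), bind M (ret M x) f = f x;
  bind_assoc : forall A B C (m : M A) (f : A -> M B) (g : B -> M C),
    bind M (bind M m f) g = bind M m (fun x => bind M (f x) g)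
}.

Record Monad := {
  monad_data :> MonadData;
  monad_laws : is_monad monad_data
}.

Record is_monad_morphism (M W : MonadData) (theta : forall A, M A -> W A)
    : Prop := {
  mor_ret : forall A (x : A), theta A (ret M x) = ret W x;
  mor_bind : forall A B (m : M A) (f : A -> M B),
    theta B (bind M m f) = bind W (theta A m) (fun x => theta B (f x))
}.

Record MonadMorphism (M W : MonadData) := {
  mor_fun :> forall A, M A -> W A;
  mor_laws : is_monad_morphism mor_fun
}.
Arguments mor_fun {M W} m {A} _.

Lemma MonadMorphism_eq (M W : MonadData) (f g : MonadMorphism M W) :
  (forall A (m : M A), f A m = g A m) -> f = g.
Proof.
  destruct f as [f Hf], g as [g Hg]; simpl; intros H.
  assert (E : f = g).
  { apply functional_extensionality_dep; intros A.
    apply functional_extensionality; apply H. }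
  subst g; f_equal; apply proof_irrelevance.
Qed.

Definition mor_id (M : MonadData) : MonadMorphism M M.
Proof. exists (fun A m => m); split; reflexivity. Defined.

Definition mor_comp (M1 M2 M3 : MonadData) (g : MonadMorphism M2 M3)
    (f : MonadMorphism M1 M2) : MonadMorphism M1 M3.
Proof.
  exists (fun A m => g A (f A m)); split.
  - intros A x. rewrite (mor_ret (mor_laws f)). apply (mor_ret (mor_laws g)).
  - intros A B m h.
    rewrite (mor_bind (mor_laws f)). apply (mor_bind (mor_laws g)).
Defined.

(** * Monadic relations *)

Record MonadicRelation (M W : MonadData) := {
  rel :> forall A, M A -> W A -> Prop;
  rel_ret : forall A (v : A), rel (ret M v) (ret W v);
  rel_bind : forall A B (m1 : M A) (w1 : W A) (m2 : A -> M B) (w2 : A -> W B),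
    rel m1 w1 -> (forall x, rel (m2 x) (w2 x)) ->
    rel (bind M m1 m2) (bind W w1 w2)
}.
Arguments rel {M W} R {A} _ _ : rename.

Definition graph (M W : MonadData) (theta : MonadMorphism M W) :
  MonadicRelation M W.
Proof.
  exists (fun A m w => theta A m = w).
  - intros A v. apply (mor_ret (mor_laws theta)).
  - intros A B m1 w1 m2 w2 H1 H2.
    rewrite (mor_bind (mor_laws theta)), H1. f_equal.
    apply functional_extensionality; exact H2.
Defined.

Record MonRelOb := {
  mr_M : Monad;
  mr_W : Monad;
  mr_rel : MonadicRelation mr_M mr_W
}.

Record MonRelHom (R1 R2 : MonRelOb) := {
  mrh_M : MonadMorphism (mr_M R1) (mr_M R2);
  mrh_W : MonadMorphism (mr_W R1) (mr_W R2);
  mrh_rel : forall A (m : mr_M R1 A) (w : mr_W R1 A),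
    rel (mr_rel R1) m w -> rel (mr_rel R2) (mrh_M A m) (mrh_W A w)
}.

Lemma MonRelHom_eq (R1 R2 : MonRelOb) (f g : MonRelHom R1 R2) :
  mrh_M f = mrh_M g -> mrh_W f = mrh_W g -> f = g.
Proof.
  destruct f as [fM fW fr], g as [gM gW gr]; simpl; intros -> ->.
  f_equal; apply proof_irrelevance.
Qed.

Definition mrh_id (R : MonRelOb) : MonRelHom R R := {|
  mrh_M := mor_id (mr_M R);
  mrh_W := mor_id (mr_W R);
  mrh_rel := fun A m w H => H
|}.

Definition mrh_comp (R1 R2 R3 : MonRelOb) (g : MonRelHom R2 R3)
    (f : MonRelHom R1 R2) : MonRelHom R1 R3 := {|
  mrh_M := mor_comp (mrh_M g) (mrh_M f);
  mrh_W := mor_comp (mrh_W g) (mrh_W f);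
  mrh_rel := fun A m w H => mrh_rel g (mrh_rel f H)
|}.

Definition MonRel : Category.
Proof.
  refine {| Ob := MonRelOb; Hom := MonRelHom; idm := mrh_id; comp := mrh_comp |};
    intros; apply MonRelHom_eq; apply MonadMorphism_eq; reflexivity.
Defined.

(** Equality with the graph is equality of predicates, i.e. pointwise logical
    equivalence. *)
Definition is_functional (R : MonRel) : Prop :=
  exists theta : MonadMorphism (mr_M R) (mr_W R),
    forall A (m : mr_M R A) (w : mr_W R A),
      rel (mr_rel R) m w <-> rel (graph theta) m w.

(** * Dijkstra monads *)

Record DijkstraData (W : MonadData) := {
  dcarrier :> forall A, W A -> Type;
  dret : forall A (x : A), dcarrier (ret W x);
  dbind : forall A B (w1 : W A) (w2 : A -> W B),
    dcarrier w1 -> (forall x, dcarrier (w2 x)) -> dcarrier (bind W w1 w2)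
}.
Arguments dcarrier {W} D A _ : rename.
Arguments dret {W} D {A} x : rename.
Arguments dbind {W} D {A B w1 w2} _ _ : rename.

(** In each equation the two sides live over specifications that are equal by
    a law of [W]; the left-hand side is transported along that law. *)
Record is_dijkstra_monad (W : Monad) (D : DijkstraData W) : Prop := {
  dbind_ret_r : forall A (w : W A) (m : D A w),
    rew [D A] bind_ret_r (monad_laws W) w in
      dbind D m (fun x => dret D x) = m;
  dbind_ret_l : forall A B (x : A) (w : A -> W B) (f : forall x, D B (w x)),
    rew [D B] bind_ret_l (monad_laws W) x w in
      dbind D (dret D x) f = f x;
  dbind_assoc : forall A B C (w1 : W A) (w2 : A -> W B) (w3 : B -> W C)
      (m : D A w1) (f : forall x, D B (w2 x)) (g : forall y, D C (w3 y)),
    rew [D C] bind_assoc (monad_laws W) w1 w2 w3 in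
      dbind D (dbind D m f) g
    = dbind D m (fun x => dbind D (f x) g)
}.

Record DMonOb := {
  dm_W : Monad;
  dm_D :> DijkstraData dm_W;
  dm_laws : is_dijkstra_monad dm_D
}.

Record is_dijkstra_morphism (W1 W2 : MonadData)
    (D1 : DijkstraData W1) (D2 : DijkstraData W2)
    (thetaW : MonadMorphism W1 W2)
    (thetaD : forall A (w : W1 A), D1 A w -> D2 A (thetaW A w)) : Prop := {
  dmor_ret : forall A (x : A),
    rew [D2 A] mor_ret (mor_laws thetaW) x in
      thetaD A (ret W1 x) (dret D1 x) = dret D2 x;
  dmor_bind : forall A B (w1 : W1 A) (w2 : A -> W1 B)
      (m : D1 A w1) (f : forall x, D1 B (w2 x)),
    rew [D2 B] mor_bind (mor_laws thetaW) w1 w2 in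
      thetaD B (bind W1 w1 w2) (dbind D1 m f)
    = dbind D2 (thetaD A w1 m) (fun x => thetaD B (w2 x) (f x))
}.

Record DMonHom (D1 D2 : DMonOb) := {
  dmh_W : MonadMorphism (dm_W D1) (dm_W D2);
  dmh_D : forall A (w : dm_W D1 A), D1 A w -> D2 A (dmh_W A w);
  dmh_laws : is_dijkstra_morphism dmh_D
}.
Arguments dmh_D {D1 D2} d {A w} _.

Lemma DMonHom_eq (D1 D2 : DMonOb)
    (tW : forall A, dm_W D1 A -> dm_W D2 A)
    (H H' : is_monad_morphism tW)
    (tD : forall A (w : dm_W D1 A), D1 A w -> D2 A (tW A w))
    (L : @is_dijkstra_morphism _ _ D1 D2 (Build_MonadMorphism H) tD)
    (L' : @is_dijkstra_morphism _ _ D1 D2 (Build_MonadMorphism H') tD) :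
  @Build_DMonHom D1 D2 (Build_MonadMorphism H) tD L
  = @Build_DMonHom D1 D2 (Build_MonadMorphism H') tD L'.
Proof.
  destruct (proof_irrelevance _ H H'). f_equal. apply proof_irrelevance.
Qed.

Lemma rew_existT (T : Type) (P : T -> Type) (x y : T) (e : x = y)
    (u : P x) (v : P y) :
  rew [P] e in u = v -> existT P x u = existT P y v.
Proof. destruct e; simpl; intros ->; reflexivity. Qed.

Lemma existT_rew (T : Type) (P : T -> Type) (x y : T) (e : x = y)
    (u : P x) (v : P y) :
  existT P x u = existT P y v -> rew [P] e in u = v.
Proof. destruct e; simpl; apply inj_pair2. Qed.

Definition dmh_id (D : DMonOb) : DMonHom D D.
Proof.
  exists (mor_id (dm_W D)) (fun A w d => d).
  split; intros; apply existT_rew; reflexivity.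
Defined.

Definition dmh_comp (D1 D2 D3 : DMonOb) (g : DMonHom D2 D3)
    (f : DMonHom D1 D2) : DMonHom D1 D3.
Proof.
  exists (mor_comp (dmh_W g) (dmh_W f)) (fun A w d => dmh_D g (dmh_D f d)).
  assert (G : forall A (w w' : dm_W D2 A) (d : D2 A w) (d' : D2 A w'),
    existT (D2 A) w d = existT (D2 A) w' d' ->
    existT (D3 A) (dmh_W g A w) (dmh_D g d)
    = existT (D3 A) (dmh_W g A w') (dmh_D g d')).
  { intros A w w' d d' E.
    exact (f_equal (fun p : {w : dm_W D2 A & D2 A w} =>
      existT (D3 A) (dmh_W g A (projT1 p)) (dmh_D g (projT2 p))) E). }
  split; intros; apply existT_rew; (eapply eq_trans; [apply G|]).
  - exact (rew_existT (dmor_ret (dmh_laws f) x)).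
  - exact (rew_existT (dmor_ret (dmh_laws g) x)).
  - exact (rew_existT (dmor_bind (dmh_laws f) m f0)).
  - exact (rew_existT (dmor_bind (dmh_laws g) _ _)).
Defined.

Definition DMon : Category.
Proof.
  refine {| Ob := DMonOb; Hom := DMonHom; idm := dmh_id; comp := dmh_comp |};
    intros; repeat match goal with
      f : DMonHom _ _ |- _ => destruct f as [[? ?] ? ?] end;
    apply DMonHom_eq.
Defined.

(** * The construction [pre] *)

Definition pre_data (M W : MonadData) (R : MonadicRelation M W) :
    DijkstraData W := {|
  dcarrier := fun A w => {m : M A | rel R m w};
  dret := fun A x => exist _ (ret M x) (rel_ret R x);
  dbind := fun A B w1 w2 m f =>
    exist _ (bind M (proj1_sig m) (fun x => proj1_sig (f x)))
      (rel_bind (proj2_sig m) (fun x => proj2_sig (f x)))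
|}.

Definition pre_map (R1 R2 : MonRel) (f : Hom R1 R2) (A : Type)
    (w : mr_W R1 A) (d : pre_data (mr_rel R1) A w) :
    pre_data (mr_rel R2) A (mrh_W f A w) :=
  exist _ (mrh_M f A (proj1_sig d)) (mrh_rel f (proj2_sig d)).

Definition pre_ob
    (pre_laws : forall R : MonRel,
      @is_dijkstra_monad (mr_W R) (pre_data (mr_rel R)))
    (R : MonRel) : DMon :=
  Build_DMonOb (pre_laws R).

Definition pre_hom
    (pre_laws : forall R : MonRel,
      @is_dijkstra_monad (mr_W R) (pre_data (mr_rel R)))
    (map_laws : forall (R1 R2 : MonRel) (f : Hom R1 R2),
      is_dijkstra_morphism (pre_map f))
    (R1 R2 : MonRel) (f : Hom R1 R2) :
    Hom (pre_ob pre_laws R1) (pre_ob pre_laws R2) :=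
  @Build_DMonHom (pre_ob pre_laws R1) (pre_ob pre_laws R2)
    (mrh_W f) (@pre_map R1 R2 f) (map_laws R1 R2 f).

(** * The construction [int] *)

Definition int_data (W : MonadData) (D : DijkstraData W) : MonadData := {|
  carrier := fun A => {w : W A & D A w};
  ret := fun A x => existT _ (ret W x) (dret D x);
  bind := fun A B m f =>
    existT _ (bind W (projT1 m) (fun x => projT1 (f x)))
      (dbind D (projT2 m) (fun x => projT2 (f x)))
|}.

Definition pi1 (W : MonadData) (D : DijkstraData W) (A : Type)
    (m : int_data D A) : W A :=
  projT1 m.

Definition int_map (D1 D2 : DMon) (f : Hom D1 D2) (A : Type)
    (m : int_data D1 A) : int_data D2 A :=
  existT _ (dmh_W f A (projT1 m)) (dmh_D f (projT2 m)).

Definition int_ob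
    (int_laws : forall D : DMon, is_monad (int_data D))
    (pi1_laws : forall D : DMon, is_monad_morphism (@pi1 (dm_W D) D))
    (D : DMon) : MonRel :=
  @Build_MonRelOb (Build_Monad (int_laws D)) (dm_W D)
    (graph (Build_MonadMorphism (pi1_laws D))).

Definition int_hom
    (int_laws : forall D : DMon, is_monad (int_data D))
    (pi1_laws : forall D : DMon, is_monad_morphism (@pi1 (dm_W D) D))
    (map_laws : forall (D1 D2 : DMon) (f : Hom D1 D2),
      is_monad_morphism (@int_map D1 D2 f))
    (map_rel : forall (D1 D2 : DMon) (f : Hom D1 D2) A
        (m : int_data D1 A) (w : dm_W D1 A),
      rel (graph (Build_MonadMorphism (pi1_laws D1))) m w ->
      rel (graph (Build_MonadMorphism (pi1_laws D2)))
        (int_map f m) (dmh_W f A w))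
    (D1 D2 : DMon) (f : Hom D1 D2) :
    Hom (int_ob int_laws pi1_laws D1) (int_ob int_laws pi1_laws D2) :=
  @Build_MonRelHom (int_ob int_laws pi1_laws D1) (int_ob int_laws pi1_laws D2)
    (Build_MonadMorphism (map_laws D1 D2 f)) (dmh_W f) (map_rel D1 D2 f).
Arguments int_hom int_laws pi1_laws map_laws map_rel {D1 D2} f.

(* Main.v *)
Require Import Defs.
From Stdlib Require Import FunctionalExtensionality ProofIrrelevance.
Import EqNotations.

(** A morphism [int D -> R] is a map sending [w] and [d : D A w] to some [m]
    related to the image of [w]; currying it gives a morphism [D -> pre R] with
    the same component on specifications.  The unit sends [d : D A w] to the
    pair [(w, d)] lying over [w], and transport along [w' = w] inverts it.  The
    counit sends [(w, m)] to [m], which is invertible when every [m] determines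
    its [w]; conversely an inverse of the counit, followed by [pi1], is a monad
    morphism whose graph is the relation. *)

Set Implicit Arguments.
Unset Strict Implicit.
Unset Printing Implicit Defensive.

(** * Adjunctions and full subcategories *)

Section Adjunctions.

Variables (C D : Category) (L : Functor C D) (R : Functor D C).
Variable adj : Adjunction L R.

Lemma fmap_id (A B : Category) (F : Functor A B) (X : A) :
  fmap F (idm X) = idm (F X).
Proof. apply (functor_id (functor_laws F)). Qed.

(** Naturality in a single variable comes from the joint law by inserting an identity in the other
    one. *)
Lemma adj_to_comp_fmap X X' (h : Hom X' X) Y (f : Hom (L X) Y) :
  adj_to adj (comp f (fmap L h)) = comp (adj_to adj f) h.
Proof.
  rewrite <- (comp_idl (comp f (fmap L h))), (adj_natural adj).
  now rewrite fmap_id, comp_idl.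
Qed.

Lemma adj_to_comp X Y Y' (k : Hom Y Y') (f : Hom (L X) Y) :
  adj_to adj (comp k f) = comp (fmap R k) (adj_to adj f).
Proof.
  rewrite <- (comp_idr f), <- (fmap_id L X), (adj_natural adj).
  now rewrite adj_to_comp_fmap.
Qed.

Lemma adj_to_inj X Y (f g : Hom (L X) Y) :
  adj_to adj f = adj_to adj g -> f = g.
Proof.
  intros E; rewrite <- (adj_toK adj f), <- (adj_toK adj g); now f_equal.
Qed.

(** Both sides are the transpose of [fmap L h]. *)
Lemma unit_natural X X' (h : Hom X X') :
  comp (unit adj X') h = comp (fmap R (fmap L h)) (unit adj X).
Proof.
  unfold unit; rewrite <- adj_to_comp_fmap, <- adj_to_comp.
  now rewrite comp_idl, comp_idr.
Qed.

(** Both sides have transpose [fmap R k], and transposition is injective. *)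
Lemma counit_natural Y Y' (k : Hom Y Y') :
  comp (counit adj Y') (fmap L (fmap R k)) = comp k (counit adj Y).
Proof.
  apply adj_to_inj; unfold counit.
  rewrite adj_to_comp_fmap, adj_to_comp, !adj_fromK.
  now rewrite comp_idl, comp_idr.
Qed.

Definition adjunction_equivalence
    (Hunit : forall X, is_iso (unit adj X))
    (Hcounit : forall Y, is_iso (counit adj Y)) : Equivalence L R := {|
  eqv_eta := unit adj;
  eqv_eps := counit adj;
  eqv_eta_natural := unit_natural;
  eqv_eps_natural := counit_natural;
  eqv_eta_iso := Hunit;
  eqv_eps_iso := Hcounit
|}.

(** Morphisms of a full subcategory are those of the ambient category by conversion, so the same hom
    bijection serves. *)
Definition adjunction_restrict (P : D -> Prop) (HL : forall X, P (L X)) :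
  Adjunction (corestrict HL) (restrict P R) :=
  @Build_Adjunction C (FullSub P) (corestrict HL) (restrict P R)
    (fun X Y => @adj_to _ _ _ _ adj X (proj1_sig Y))
    (fun X Y => @adj_from _ _ _ _ adj X (proj1_sig Y))
    (fun X Y => @adj_toK _ _ _ _ adj X (proj1_sig Y))
    (fun X Y => @adj_fromK _ _ _ _ adj X (proj1_sig Y))
    (fun X X' Y Y' => @adj_natural _ _ _ _ adj X X' (proj1_sig Y) (proj1_sig Y')).

End Adjunctions.

(** * Equality of morphisms *)

(** The images of [d] live in different types until [f] and [g] are known to agree on
    specifications, so they are compared in the total space. *)
Lemma DMonHom_ext (D1 D2 : DMonOb) (f g : DMonHom D1 D2) :
  (forall A (w : dm_W D1 A), dmh_W f A w = dmh_W g A w) ->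
  (forall A (w : dm_W D1 A) (d : D1 A w),
    existT (D2 A) _ (dmh_D f d) = existT (D2 A) _ (dmh_D g d)) ->
  f = g.
Proof.
  destruct f as [fW fD fl], g as [gW gD gl]; simpl; intros HW HD.
  pose proof (MonadMorphism_eq HW); subst gW.
  assert (E : fD = gD).
  { do 2 (apply functional_extensionality_dep; intro).
    apply functional_extensionality; intro d.
    apply (inj_pair2 _ _ _ _ _ (HD _ _ d)). }
  subst gD; f_equal; apply proof_irrelevance.
Qed.

Lemma MonRelHom_ext (R1 R2 : MonRelOb) (f g : MonRelHom R1 R2) :
  (forall A (m : mr_M R1 A), mrh_M f A m = mrh_M g A m) ->
  (forall A (w : mr_W R1 A), mrh_W f A w = mrh_W g A w) ->
  f = g.
Proof. intros HM HW; apply MonRelHom_eq; now apply MonadMorphism_eq. Qed.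

Lemma sig_eq (T : Type) (P : T -> Prop) (u v : {x : T | P x}) :
  proj1_sig u = proj1_sig v -> u = v.
Proof.
  destruct u as [x p], v as [y q]; simpl; intros ->.
  f_equal; apply proof_irrelevance.
Qed.

(** Since [S] does not vary with [w], the two components can be compared independently. With
    [existT_rew], a transported equation about [pre] thus becomes one equation in [W] and one in
    [M]. *)
Lemma existT_sig_eq (T S : Type) (P : S -> T -> Prop) (w w' : T)
    (u : {m : S | P m w}) (u' : {m : S | P m w'}) :
  w = w' -> proj1_sig u = proj1_sig u' ->
  existT (fun w => {m : S | P m w}) w u
  = existT (fun w => {m : S | P m w}) w' u'.
Proof. intros -> E; f_equal; now apply sig_eq. Qed.

Lemma existT_rew_eq (T : Type) (P : T -> Type) (w : T) (p : {x : T & P x})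
    (e : projT1 p = w) :
  existT P w (rew [P] e in projT2 p) = p.
Proof. destruct e, p; reflexivity. Qed.

(** * The functor [pre] *)

Lemma pre_laws (R : MonRel) :
  @is_dijkstra_monad (mr_W R) (pre_data (mr_rel R)).
Proof.
  split; intros; apply existT_rew, existT_sig_eq; simpl.
  - apply (bind_ret_r (monad_laws (mr_W R))).
  - apply (bind_ret_r (monad_laws (mr_M R))).
  - apply (bind_ret_l (monad_laws (mr_W R))).
  - apply (bind_ret_l (monad_laws (mr_M R)) x (fun x => proj1_sig (f x))).
  - apply (bind_assoc (monad_laws (mr_W R))).
  - apply (bind_assoc (monad_laws (mr_M R)) _
      (fun x => proj1_sig (f x)) (fun x => proj1_sig (g x))).
Qed.

Lemma pre_map_laws (R1 R2 : MonRel) (f : Hom R1 R2) :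
  is_dijkstra_morphism (pre_map f).
Proof.
  split; intros; apply existT_rew, existT_sig_eq; simpl.
  - apply (mor_ret (mor_laws (mrh_W f))).
  - apply (mor_ret (mor_laws (mrh_M f))).
  - apply (mor_bind (mor_laws (mrh_W f))).
  - apply (mor_bind (mor_laws (mrh_M f))).
Qed.

Lemma pre_functor : is_functor (pre_hom pre_laws pre_map_laws).
Proof.
  split; intros; apply DMonHom_ext; simpl; intros; try reflexivity;
    now apply existT_sig_eq.
Qed.

Definition pre : Functor MonRel DMon := Build_Functor pre_functor.

(** * The functor [int] *)

(** Read in the total space, each transported law of [D] is a law for pairs. *)
Lemma int_laws (D : DMon) : is_monad (int_data D).
Proof.
  split.
  - intros A [w m]; exact (rew_existT (dbind_ret_r (dm_laws D) m)).
  - intros A B x f.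
    eapply eq_trans;
      [exact (rew_existT (dbind_ret_l (dm_laws D) x (fun x => projT2 (f x))))|].
    (* What is left is the pair rebuilt from the projections of [f x], equal to [f x] only after
       case analysis. *)
    destruct (f x); reflexivity.
  - intros A B C m f g.
    exact (rew_existT (dbind_assoc (dm_laws D) (projT2 m)
      (fun x => projT2 (f x)) (fun x => projT2 (g x)))).
Qed.

Lemma pi1_laws (D : DMon) : is_monad_morphism (@pi1 (dm_W D) D).
Proof. split; reflexivity. Qed.

Lemma int_map_laws (D1 D2 : DMon) (f : Hom D1 D2) :
  is_monad_morphism (@int_map D1 D2 f).
Proof.
  split; intros.
  - exact (rew_existT (dmor_ret (dmh_laws f) x)).
  - exact (rew_existT (dmor_bind (dmh_laws f) _ _)).
Qed.

Lemma int_map_rel (D1 D2 : DMon) (f : Hom D1 D2) (A : Type)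
    (m : int_data D1 A) (w : dm_W D1 A) :
  rel (graph (Build_MonadMorphism (pi1_laws D1))) m w ->
  rel (graph (Build_MonadMorphism (pi1_laws D2))) (int_map f m) (dmh_W f A w).
Proof. intros <-; reflexivity. Qed.

Lemma int_functor :
  is_functor (@int_hom int_laws pi1_laws int_map_laws int_map_rel).
Proof.
  split; intros; apply MonRelHom_ext; simpl; try reflexivity.
  intros A [w d]; reflexivity.
Qed.

Definition int : Functor DMon MonRel := Build_Functor int_functor.

Lemma int_functional (D : DMon) : is_functional (int D).
Proof. exists (Build_MonadMorphism (pi1_laws D)); intros; apply iff_refl. Qed.

(** * The adjunction *)

(** The relation of [int D] is the graph of [pi1], so [eq_refl] proves that the pair lies over
    [w]. *)
Definition curry_map (D : DMon) (R : MonRel) (f : Hom (int D) R) (A : Type)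
    (w : dm_W D A) (d : D A w) : pre R A (mrh_W f A w) :=
  exist _ (mrh_M f A (existT (D A) w d)) (mrh_rel f eq_refl).

Lemma curry_laws (D : DMon) (R : MonRel) (f : Hom (int D) R) :
  @is_dijkstra_morphism _ _ D (pre R) (mrh_W f) (@curry_map D R f).
Proof.
  split; intros; apply existT_rew, existT_sig_eq; simpl.
  - apply (mor_ret (mor_laws (mrh_W f))).
  - apply (mor_ret (mor_laws (mrh_M f))).
  - apply (mor_bind (mor_laws (mrh_W f))).
  - apply (mor_bind (mor_laws (mrh_M f)) (existT (D A) w1 m)
      (fun x => existT (D B) (w2 x) (f0 x))).
Qed.

Definition curry (D : DMon) (R : MonRel) (f : Hom (int D) R) :
  Hom D (pre R) := Build_DMonHom (D2 := pre R) (curry_laws f).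

Definition uncurry_map (D : DMon) (R : MonRel) (g : Hom D (pre R)) (A : Type)
    (m : int_data D A) : mr_M R A :=
  proj1_sig (dmh_D g (projT2 m)).

(* The first projection of [pre R A w] does not depend on [w], so it extends to
   the total space and turns equalities over [w] into equalities in [M]. *)
Lemma uncurry_laws (D : DMon) (R : MonRel) (g : Hom D (pre R)) :
  @is_monad_morphism (int_data D) (mr_M R) (@uncurry_map D R g).
Proof.
  split; intros.
  - exact (f_equal (fun p => proj1_sig (projT2 p))
      (rew_existT (dmor_ret (dmh_laws g) x))).
  - exact (f_equal (fun p => proj1_sig (projT2 p))
      (rew_existT (dmor_bind (dmh_laws g) (projT2 m) (fun x => projT2 (f x))))).
Qed.

Lemma uncurry_rel (D : DMon) (R : MonRel) (g : Hom D (pre R)) A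
    (m : int_data D A) (w : dm_W D A) :
  pi1 m = w -> rel (mr_rel R) (uncurry_map g m) (dmh_W g A w).
Proof. intros <-; exact (proj2_sig (dmh_D g (projT2 m))). Qed.

Definition uncurry (D : DMon) (R : MonRel) (g : Hom D (pre R)) :
  Hom (int D) R :=
  @Build_MonRelHom (int D) R (Build_MonadMorphism (uncurry_laws g)) (dmh_W g)
    (@uncurry_rel D R g).

Definition int_pre_adjunction : Adjunction int pre.
Proof.
  exists curry uncurry.
  - intros D R f; apply MonRelHom_ext; simpl; try reflexivity.
    intros A [w d]; reflexivity.
  - intros D R g; apply DMonHom_ext; simpl; try reflexivity.
    intros; now apply existT_sig_eq.
  - intros; apply DMonHom_ext; simpl; try reflexivity.
    intros; now apply existT_sig_eq.
Defined.

(** * Unit and counit *)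

Definition unit_inv_map (D : DMon) (A : Type) (w : dm_W D A)
    (d : pre (int D) A w) : D A w :=
  rew [D A] proj2_sig d in projT2 (proj1_sig d).

Lemma unit_inv_laws (D : DMon) :
  @is_dijkstra_morphism _ _ (pre (int D)) D (mor_id (dm_W D))
    (@unit_inv_map D).
Proof.
  split; intros; apply existT_rew.
  - apply existT_rew_eq.
  - eapply eq_trans; [apply existT_rew_eq|].
    (* Pairing [unit_inv_map d] with its index gives back the pair stored in [d], so the two binds
       have equal arguments. *)
    change (bind (int_data D) (proj1_sig m) (fun x => proj1_sig (f x))
      = bind (int_data D) (existT (D A) w1 (unit_inv_map m))
          (fun x => existT (D B) (w2 x) (unit_inv_map (f x)))).
    f_equal; [|apply functional_extensionality; intro x];
      symmetry; apply existT_rew_eq.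
Qed.

Definition unit_inv (D : DMon) : Hom (pre (int D)) D :=
  Build_DMonHom (D1 := pre (int D)) (D2 := D) (unit_inv_laws D).

Lemma unit_iso (D : DMon) : is_iso (unit int_pre_adjunction D).
Proof.
  exists (unit_inv D); split; apply DMonHom_ext; simpl; try reflexivity.
  intros A w d; apply existT_sig_eq; [reflexivity|].
  apply existT_rew_eq.
Qed.

(** By [H], [m] is related to [theta A m] and to nothing else, which forces the first component. *)
Definition counit_inv_map (R : MonRel)
    (theta : MonadMorphism (mr_M R) (mr_W R))
    (H : forall A (m : mr_M R A) w, rel (mr_rel R) m w <-> theta A m = w)
    (A : Type) (m : mr_M R A) : int_data (pre R) A :=
  existT (pre R A) (theta A m) (exist _ m (proj2 (H A m _) eq_refl)).

Lemma counit_inv_laws (R : MonRel) (theta : MonadMorphism (mr_M R) (mr_W R))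
    (H : forall A (m : mr_M R A) w, rel (mr_rel R) m w <-> theta A m = w) :
  @is_monad_morphism (mr_M R) (int_data (pre R)) (counit_inv_map H).
Proof.
  split; intros; apply existT_sig_eq; try reflexivity.
  - apply (mor_ret (mor_laws theta)).
  - apply (mor_bind (mor_laws theta)).
Qed.

Definition counit_inv (R : MonRel) (theta : MonadMorphism (mr_M R) (mr_W R))
    (H : forall A (m : mr_M R A) w, rel (mr_rel R) m w <-> theta A m = w) :
  Hom R (int (pre R)) :=
  @Build_MonRelHom R (int (pre R)) (Build_MonadMorphism (counit_inv_laws H))
    (mor_id (mr_W R)) (fun A m w => proj1 (H A m w)).

Lemma counit_iso (R : MonRel) :
  is_iso (counit int_pre_adjunction R) <-> is_functional R.
Proof.
  split.
  - intros [g [_ Hg]].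
    exists (mor_comp (Build_MonadMorphism (pi1_laws (pre R))) (mrh_M g)).
    assert (EM : forall A m,
      mrh_M (counit int_pre_adjunction R) A (mrh_M g A m) = m).
    { intros A m.
      exact (f_equal (fun h : MonRelHom R R => mrh_M h A m) Hg). }
    assert (EW : forall A w, mrh_W g A w = w).
    { intros A w.
      exact (f_equal (fun h : MonRelHom R R => mrh_W h A w) Hg). }
    intros A m w; split.
    (* [g] maps related elements into the graph of [pi1], and it fixes [w]. *)
    + intros H; rewrite <- (EW A w); exact (mrh_rel g H).
    (* The counit preserves relatedness, sends the image of [m] under [g] back to [m], and is the
       identity on specifications. *)
    + intros H; rewrite <- (EM A m).
      exact (mrh_rel (counit int_pre_adjunction R) H).
  - intros [theta H].
    exists (counit_inv H); split; apply MonRelHom_ext; simpl; try reflexivity.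
    (* The round trip replaces [w] by [theta A m]; the proof [r] shows that they coincide. *)
    intros A [w [m r]]; apply existT_sig_eq; [|reflexivity].
    apply (H A m w), r.
Qed.

Theorem mainTheorem2 :
  exists
    (* pre R is a Dijkstra monad, and pre is a functor *)
    (pre_laws : forall R : MonRel,
       @is_dijkstra_monad (mr_W R) (pre_data (mr_rel R)))
    (pre_map_laws : forall (R1 R2 : MonRel) (f : Hom R1 R2),
       is_dijkstra_morphism (pre_map f))
    (pre_functor : is_functor (pre_hom pre_laws pre_map_laws))
    (* int D is a monad, its projection is a monad morphism, and sending D to
       the graph of the projection is a functor *)
    (int_laws : forall D : DMon, is_monad (int_data D))
    (pi1_laws : forall D : DMon, is_monad_morphism (@pi1 (dm_W D) D))
    (int_map_laws : forall (D1 D2 : DMon) (f : Hom D1 D2),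
       is_monad_morphism (@int_map D1 D2 f))
    (int_map_rel : forall (D1 D2 : DMon) (f : Hom D1 D2) (A : Type)
         (m : int_data D1 A) (w : dm_W D1 A),
       rel (graph (Build_MonadMorphism (pi1_laws D1))) m w ->
       rel (graph (Build_MonadMorphism (pi1_laws D2)))
         (int_map f m) (dmh_W f A w))
    (int_functor :
       is_functor (@int_hom int_laws pi1_laws int_map_laws int_map_rel)),
  let pre : Functor MonRel DMon := Build_Functor pre_functor in
  let int : Functor DMon MonRel := Build_Functor int_functor in
  (* (1) *)
  exists adj : Adjunction int pre,
  (* (2) *)
  (forall D : DMon, is_iso (unit adj D)) /\
  (* (3) *)
  (forall R : MonRel, is_iso (counit adj R) <-> is_functional R) /\
  (* (4) *)
  (exists int_functional : forall D : DMon, is_functional (int D),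
   let int' : Functor DMon (FullSub is_functional) :=
     corestrict int_functional in
   let pre' : Functor (FullSub is_functional) DMon :=
     restrict is_functional pre in
   exists (adj' : Adjunction int' pre') (E : Equivalence int' pre'),
   (forall (D : DMon) (R : FullSub is_functional)
      (f : Hom (int D) (proj1_sig R)), adj_to adj' f = adj_to adj f) /\
   (forall D : DMon, eqv_eta E D = unit adj' D) /\
   (forall R : FullSub is_functional, eqv_eps E R = counit adj' R)).
Proof.
  exists pre_laws, pre_map_laws, pre_functor, int_laws, pi1_laws, int_map_laws,
    int_map_rel, int_functor.
  exists int_pre_adjunction.
  split; [exact unit_iso|]. split; [exact counit_iso|].
  exists int_functional.
  exists (adjunction_restrict int_pre_adjunction int_functional).
  unshelve eexists.
  - apply (adjunction_equivalence
      (adj := adjunction_restrict int_pre_adjunction int_functional)).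
    (* The unit and counit of the restricted adjunction are convertible to the original ones, so
       invertibility carries over. *)
    + exact unit_iso.
    + intros [R HR]; exact (proj2 (counit_iso R) HR).
  - repeat split; reflexivity.
Qed.
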